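(* Let $n\ge 1$ and $0\le k\le n$ be integers. For the simple random walk $X$ on $\mathbb{Z}$, $$\mathbf{P}\bigl(X(2n)\text{ is on the positive side}\ \big|\ T_{2n}=2k\bigr)=\frac{k}{n}.$$
   Context: The simple random walk on $\mathbb{Z}$ up to time $N$ is a uniformly random element $X$ of $\mathcal{P}_N$, the finite set of all functions $X:\{0,1,\dots,N\}\to\mathbb{Z}$ with $X(0)=0$ and $|X(t)-X(t-1)|=1$ for all $1\le t\le N$ (so each of the $2^N$ paths has probability $2^{-N}$); here $N=2n$. For a positive integer $t$, ''$X(t)$ is on the positive side'' means $X(t)\ge 0$ and $X(t-1)\ge 0$. The sojourn time on the positive side is $T_N=\#\{t\in\{1,\dots,N\}: X(t)\text{ is on the positive side}\}$. $\mathbf{P}(A\mid B)$ is the usual conditional probability. *)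

(* Defs.v *)
From HB Require Import structures.
From mathcomp Require Import all_boot all_order all_algebra.
From mathcomp Require Import zify.

Set Implicit Arguments.
Unset Strict Implicit.
Unset Printing Implicit Defensive.
Import Order.TTheory GRing.Theory Num.Theory.
Local Open Scope ring_scope.

(* [inord t.-1] is the time t - 1; it is only used under [0 < t]. *)
Definition is_walk (N : nat) (X : {ffun 'I_N.+1 -> int}) : bool :=
  (X ord0 == 0) &&
  [forall t : 'I_N.+1, (0 < t)%N ==> (`|X t - X (inord t.-1)| == 1)].

Record walk (N : nat) : Type := Walk {
  walk_fun :> {ffun 'I_N.+1 -> int};
  walkP : is_walk walk_fun }.

HB.instance Definition _ N := [isSub for @walk_fun N].

(* The finType structure on [walk N] comes from the bijection between walks
   and sequences of signs. *)
Definition walk_steps (N : nat) (X : walk N) : {ffun 'I_N -> bool} :=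
  [ffun i : 'I_N => X (inord i.+1) < X (inord i)].

Definition steps_fun (N : nat) (s : {ffun 'I_N -> bool}) :
    {ffun 'I_N.+1 -> int} :=
  [ffun t : 'I_N.+1 => \sum_(i < N | (i < t)%N) (-1) ^+ s i].

Lemma steps_fun_succ (N : nat) (s : {ffun 'I_N -> bool}) (i : 'I_N) :
  steps_fun s (inord i.+1) = steps_fun s (inord i) + (-1) ^+ s i.
Proof.
have iN := ltn_ord i.
rewrite !ffunE !inordK; [|lia..].
rewrite (bigD1 i) ?ltnS //= addrC; congr (_ + _); apply: eq_bigl => j.
by rewrite ltnS ltn_neqAle andbC -(inj_eq val_inj).
Qed.

Lemma steps_fun_is_walk (N : nat) (s : {ffun 'I_N -> bool}) :
  is_walk (steps_fun s).
Proof.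
apply/andP; split; first by rewrite ffunE big_pred0.
apply/forallP => -[[|t] tN]; apply/implyP => //= _.
have -> : Ordinal tN = inord t.+1 by apply: val_inj; rewrite /= inordK.
have /= -> := @steps_fun_succ N s (Ordinal (tN : t < N)%N).
by rewrite addrC addKr normrX normrN1 expr1n.
Qed.

Definition steps_walk (N : nat) (s : {ffun 'I_N -> bool}) : walk N :=
  Walk (steps_fun_is_walk s).

Lemma steps_walkK (N : nat) : cancel (@steps_walk N) (@walk_steps N).
Proof.
move=> s; apply/ffunP => i; rewrite ffunE /= steps_fun_succ.
by case: (s i); rewrite /= ?expr1 ?expr0; lia.
Qed.

Lemma walk_stepsK (N : nat) : cancel (@walk_steps N) (@steps_walk N).
Proof.
move=> X; apply/val_inj/ffunP => /= t.
have /andP[/eqP X0 /forallP XS] := walkP X.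
have -> : t = inord t by apply: val_inj; rewrite /= inordK.
have : (t <= N)%N by rewrite -ltnS.
elim: (t : nat) => [|m IHm] mN.
  have -> : inord 0 = ord0 :> 'I_N.+1 by apply: val_inj; rewrite /= inordK.
  by rewrite X0 ffunE big_pred0.
have /= -> := @steps_fun_succ N (walk_steps X) (Ordinal mN).
rewrite IHm ?ffunE /=; last exact: ltnW.
have /implyP := XS (inord m.+1); rewrite inordK // => /(_ isT) /=.
by case: ltP; rewrite /= ?expr1 ?expr0; lia.
Qed.

HB.instance Definition _ N :=
  Finite.copy (walk N) (can_type (@walk_stepsK N)).

Lemma card_walk (N : nat) : #|{: walk N}| = (2 ^ N)%N.
Proof.
have bij : bijective (@walk_steps N).
  exact: Bijective (@walk_stepsK N) (@steps_walkK N).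
by rewrite (bij_eq_card bij) card_ffun card_bool card_ord.
Qed.

Definition prob (R : realFieldType) (Omega : finType) (A : {set Omega}) : R :=
  #|A|%:R / #|Omega|%:R.

(* Equals 0 when [prob R B = 0]; see [prob_sojourn_gt0] below. *)
Definition cond_prob (R : realFieldType) (Omega : finType)
    (A B : {set Omega}) : R :=
  prob R (A :&: B) / prob R B.

(* Meaningful for [0 < t] only. *)
Definition positive_side (N : nat) (X : walk N) (t : 'I_N.+1) : bool :=
  (0 <= X t) && (0 <= X (inord t.-1)).

Definition sojourn (N : nat) (X : walk N) : nat :=
  #|[set t : 'I_N.+1 | (0 < t)%N && positive_side X t]|.

Lemma prob_sojourn_gt0 (R : realFieldType) (n k : nat) : (k <= n)%N ->
  0 < prob R [set X : walk (2 * n) | sojourn X == (2 * k)%N].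
Proof.
move=> kn; rewrite /prob card_walk divr_gt0 ?ltr0n ?expn_gt0 //.
pose z (t : nat) : int := if (t <= 2 * k)%N then (odd t)%:Z else - (odd t)%:Z.
pose f : {ffun 'I_(2 * n).+1 -> int} := [ffun t : 'I_(2 * n).+1 => z t].
have fP : is_walk f.
  apply/andP; split; first by rewrite ffunE.
  apply/forallP => t; apply/implyP => t0; rewrite !ffunE inordK; last first.
    by have := ltn_ord t; lia.
  by rewrite /z; case: ifP; case: ifP; lia.
apply/card_gt0P; exists (Walk fP); rewrite inE /sojourn; apply/eqP.
have inj : injective
    (fun i : 'I_(2 * k) => lift ord0 (widen_ord (leq_mul (leqnn 2) kn) i)).
  by move=> i j /lift_inj /(congr1 val) /= /val_inj.
rewrite -[RHS]card_ord -(card_imset predT inj); apply: eq_card => t.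
rewrite inE /positive_side /= !ffunE inordK; last by have := ltn_ord t; lia.
apply/idP/imsetP => [tP|[i _ ->]].
  have tk : (t.-1 < 2 * k)%N by move: tP; rewrite /z; case: ifP; case: ifP; lia.
  by exists (Ordinal tk) => //; apply: val_inj; rewrite /= /bump; lia.
by have := ltn_ord i; rewrite /z /= /bump; case: ifP; case: ifP; lia.
Qed.

(* Main.v *)
(* Let w(p, q, x) count the walks from 0 to x with p steps on the positive side
   and q on the negative side, and let c(q) = w(0, q, 0).  Conditioning on the
   last step gives recursions from which one proves, simultaneously,
     w(p + 2, q, x + 1) = w(p, q + 2, x + 1) + c(q) w(p + 1, 0, x)  and
     w(p + 2, q, 0) = w(p, q + 2, 0),
   the latter because the two contributions c(p) c(q) cancel.  Summing over
   x >= 0, the number of walks with p steps on the positive side, the last step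
   among them, is a telescoping sum of products of a Catalan number and a
   central binomial coefficient; by induction the number of such walks of length
   2n with p = 2k is (k/n) C(2k, k) C(2n - 2k, n - k).  The reflection X -> -X
   deals with the walks ending on the negative side. *)
Require Import Defs.
From mathcomp Require Import all_boot all_order all_algebra.
From mathcomp Require Import zify.
Set Implicit Arguments.
Unset Strict Implicit.
Unset Printing Implicit Defensive.
Import Order.TTheory GRing.Theory Num.Theory.
Local Open Scope ring_scope.

(** * Extending a walk by one step *)

Lemma walk_step (N : nat) (X : walk N) (t : 'I_N.+1) :
  (0 < t)%N -> `|X t - X (inord t.-1)| = 1.
Proof. by have /andP[_ /forallP /(_ t)/implyP XS] := walkP X; move=> /XS/eqP. Qed.

Definition extend_fun (N : nat) (X : walk N) (b : bool) :
    {ffun 'I_N.+2 -> int} :=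
  [ffun t : 'I_N.+2 =>
    if (t <= N)%N then X (inord t) else X ord_max + (-1) ^+ b].

Lemma extend_is_walk (N : nat) (X : walk N) (b : bool) :
  is_walk (extend_fun X b).
Proof.
apply/andP; split.
  rewrite ffunE /=; have /andP[/eqP <- _] := walkP X.
  by apply/eqP; congr (X _); apply: val_inj; rewrite /= inordK.
apply/forallP => t; apply/implyP => t0; have tN := ltn_ord t.
rewrite !ffunE inordK; last by lia.
have -> : (t.-1 <= N)%N by lia.
case: leqP => [tN1|Nt].
  have := @walk_step _ X (inord t); rewrite inordK; last by lia.
  by move=> ->.
have -> : inord t.-1 = ord_max :> 'I_N.+1.
  by apply: val_inj; rewrite /= inordK; lia.
by rewrite addrC addKr normrX normrN1 expr1n.
Qed.

Definition extend (N : nat) (X : walk N) (b : bool) : walk N.+1 :=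
  Walk (extend_is_walk X b).

Lemma extend_last (N : nat) (X : walk N) (b : bool) :
  extend X b ord_max = X ord_max + (-1) ^+ b.
Proof. by rewrite ffunE /= ltnn. Qed.

Lemma extend_old (N : nat) (X : walk N) (b : bool) (t : nat) : (t <= N)%N ->
  extend X b (inord t) = X (inord t).
Proof. by move=> tN; rewrite ffunE inordK ?tN // ltnS leqW. Qed.

(** Injectivity suffices, since both sides have [2 ^ N.+1] elements. *)
Lemma extend_bij (N : nat) :
  bijective (fun p : walk N * bool => extend p.1 p.2).
Proof.
apply: inj_card_bij => [[X b] [Y c] /= eXY|]; last first.
  by rewrite card_prod !card_walk card_bool expnSr.
have XY : X = Y.
  apply/val_inj/ffunP => t; rewrite /= -(inord_val t).
  have tN : (t <= N)%N by rewrite -ltnS.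
  by rewrite -(@extend_old _ X b) // -(@extend_old _ Y c) // eXY.
have := extend_last X b; rewrite eXY extend_last XY => /addrI.
by case: b c {eXY} => [] [].
Qed.

Lemma positive_side_extend (N : nat) (X : walk N) (b : bool) :
  positive_side (extend X b) ord_max =
  (0 <= X ord_max + (-1) ^+ b) && (0 <= X ord_max).
Proof.
rewrite /positive_side extend_last extend_old //=.
by congr (_ && (0 <= X _)); apply: val_inj; rewrite /= inordK.
Qed.

Lemma sojournE (N : nat) (X : walk N) :
  sojourn X = (\sum_(t < N.+1) ((0 < t) && positive_side X t))%N.
Proof.
rewrite /sojourn cardsE -sum1_card big_mkcond; apply: eq_bigr => t _.
by rewrite unfold_in; case: (_ && _).
Qed.

Lemma sojourn_extend (N : nat) (X : walk N) (b : bool) :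
  sojourn (extend X b) =
  (sojourn X + ((0 <= X ord_max + (-1) ^+ b)%R && (0 <= X ord_max)%R))%N.
Proof.
rewrite !sojournE big_ord_recr /= -positive_side_extend; congr addn.
apply: eq_bigr => t _; congr nat_of_bool; congr andb.
have tN := ltn_ord t.
rewrite /positive_side /= extend_old; last by lia.
have -> : widen_ord (leqnSn N.+1) t = inord t.
  by apply: val_inj; rewrite /= inordK //; lia.
by rewrite extend_old ?inord_val.
Qed.

Lemma card_walkS (N : nat) (P : pred (walk N.+1)) :
  #|P| = (#|[pred X : walk N | P (extend X false)]| +
          #|[pred X : walk N | P (extend X true)]|)%N.
Proof.
rewrite -!sum1_card (reindex _ (onW_bij _ (extend_bij N))) /=.
rewrite -(pair_big_dep predT (fun X b => extend X b \in P)
  (fun _ _ => 1%N)) /=.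
rewrite big_mkcond [in RHS]big_mkcond [X in (_ + X)%N]big_mkcond -big_split /=.
by apply: eq_bigr => X _; rewrite big_mkcond big_bool addnC.
Qed.

(** * Counting by endpoint and sojourn time; reflection *)

Definition count (N : nat) (x : int) (j : nat) : nat :=
  #|[pred X : walk N | (X ord_max == x) && (sojourn X == j)]|.

Lemma count0 (x : int) (j : nat) :
  count 0 x j = ((x == 0) && (j == 0)%N) :> nat.
Proof.
have -> : count 0 x j =
    (#|[pred X : walk 0 | true]| * ((x == 0) && (j == 0%N)))%N.
  have last0 (X : walk 0) : X ord_max = 0.
    rewrite (_ : ord_max = ord0); last exact: ord1.
    by have /andP[/eqP] := walkP X.
  rewrite /count; case: (boolP (_ && _)) => [/andP[/eqP-> /eqP->]|xj].
    by rewrite muln1; apply: eq_card => X; rewrite !inE sojournE big_ord1 last0.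
  rewrite muln0; apply: eq_card0 => X; rewrite !inE sojournE big_ord1 last0 /=.
  by apply: contraNF xj; rewrite ![_ == j]eq_sym eq_sym.
by rewrite card_walk mul1n.
Qed.

(** Split on the last step: on the positive side it uses up one unit of [j], which is impossible for
    [j = 0]. *)
Lemma countS (N : nat) (x : int) (j : nat) :
  count N.+1 x j =
  ((if (0 <= x)%R && (0 <= x - 1)%R
    then if j is j'.+1 then count N (x - 1) j' else 0 else count N (x - 1) j) +
   (if (0 <= x)%R && (0 <= x + 1)%R
    then if j is j'.+1 then count N (x + 1) j' else 0 else count N (x + 1) j))%N.
Proof.
rewrite /count card_walkS; congr addn.
- case: ifP => [xP|xP].
    case: j => [|j]; [apply: eq_card0|apply: eq_card] => X; rewrite !inE;
    rewrite extend_last sojourn_extend expr0; lia.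
  by apply: eq_card => X; rewrite !inE extend_last sojourn_extend expr0; lia.
- case: ifP => [xP|xP].
    case: j => [|j]; [apply: eq_card0|apply: eq_card] => X; rewrite !inE;
    rewrite extend_last sojourn_extend expr1; lia.
  by apply: eq_card => X; rewrite !inE extend_last sojourn_extend expr1; lia.
Qed.

Lemma opp_is_walk (N : nat) (X : walk N) : is_walk [ffun t => - X t].
Proof.
have /andP[/eqP X0 /forallP XS] := walkP X.
apply/andP; split; first by rewrite ffunE X0.
apply/forallP => t; apply/implyP => t0; rewrite !ffunE.
by rewrite -opprD normrN (implyP (XS t)).
Qed.

Definition opp_walk (N : nat) (X : walk N) : walk N := Walk (opp_is_walk X).

Lemma opp_walkK (N : nat) : involutive (@opp_walk N).
Proof. by move=> X; apply/val_inj/ffunP => t; rewrite /= !ffunE opprK. Qed.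

(** Consecutive positions differ by 1, so they are neither both 0 nor of strictly opposite signs. *)
Lemma positive_side_opp (N : nat) (X : walk N) (t : 'I_N.+1) :
  (0 < t)%N -> positive_side (opp_walk X) t = ~~ positive_side X t.
Proof. by move=> /(walk_step X); rewrite /positive_side !ffunE; lia. Qed.

Lemma sojourn_opp (N : nat) (X : walk N) :
  (sojourn X + sojourn (opp_walk X) = N)%N.
Proof.
rewrite !sojournE -big_split /= big_ord_recl /=.
under eq_bigr do rewrite positive_side_opp // addnC addn_negb.
by rewrite sum1_card card_ord.
Qed.

Lemma count_opp (p q : nat) (x : int) :
  count (p + q) x p = count (q + p) (- x) q.
Proof.
rewrite [in RHS]addnC /count -(card_image (inv_inj (@opp_walkK _))).
apply: eq_card => X; rewrite -[X in LHS]opp_walkK mem_image; last first.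
  exact: inv_inj (@opp_walkK _).
have := sojourn_opp X; rewrite !inE !ffunE; lia.
Qed.

(** * Recursions and shift identities *)

(* [p] and [q] are the numbers of steps on the positive and the negative side. *)
Definition npaths (p q x : nat) : nat := count (p + q) x%:Z p.

Lemma npaths00 : npaths 0 0 0 = 1%N.
Proof. by rewrite /npaths count0. Qed.

Lemma npaths0S (q x : nat) : npaths 0 q x.+1 = 0%N.
Proof.
case: q => [|q]; first by rewrite /npaths count0.
have [x0 xN xP] :
    [/\ 0 <= x.+1%:Z, 0 <= x.+1%:Z - 1 & 0 <= x.+1%:Z + 1] by split; lia.
by rewrite /npaths countS x0 xN xP.
Qed.

Lemma npathsSS (p q x : nat) :
  npaths p.+1 q x.+1 = (npaths p q x + npaths p q x.+2)%N.
Proof.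
have [x0 xN xP] :
    [/\ 0 <= x.+1%:Z, 0 <= x.+1%:Z - 1 & 0 <= x.+1%:Z + 1] by split; lia.
rewrite /npaths countS x0 xN xP /=.
by congr (count _ _ _ + count _ _ _)%N; lia.
Qed.

Lemma npathsC0 (p q : nat) : npaths p q 0 = npaths q p 0.
Proof. by rewrite /npaths count_opp oppr0. Qed.

Lemma count_gt (N j : nat) (x : int) : (N < j)%N -> count N x j = 0%N.
Proof.
move=> Nj; apply: eq_card0 => X; have := sojourn_opp X.
by rewrite !inE; lia.
Qed.

(** Walks arriving from -1 are reflected, which exchanges the two kinds of steps. *)
Lemma npathsS0 (p q : nat) : (0 < p + q)%N -> npaths p q 0 =
  ((if p is p'.+1 then npaths p' q 1 else 0) +
   (if q is q'.+1 then npaths q' p 1 else 0))%N.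
Proof.
case Npq: (p + q)%N => [//|N] _.
have -> : npaths p q 0 =
    ((if p is p'.+1 then count N 1 p' else 0) + count N (-1) p)%N.
  by rewrite /npaths Npq countS addnC.
congr addn.
  by case: p Npq => // p [<-].
case: q Npq => [|q]; first by rewrite addn0 => pN; rewrite count_gt // pN.
by rewrite addnS => -[<-]; rewrite count_opp.
Qed.

Lemma npaths_gt (p q x : nat) : (p < x)%N -> npaths p q x = 0%N.
Proof.
elim: p x => [|p IHp] [|x] // px; first exact: npaths0S.
by rewrite npathsSS !IHp //; lia.
Qed.

(** The negative steps of a walk ending at [x >= 0] form excursions from 0 to 0, of even length; the
    endpoint has the parity of the length. *)
Lemma npaths_odd (p q x : nat) : odd q || odd (p + q + x) -> npaths p q x = 0%N.
Proof.
have [s] := ubnP (p + q); elim: s p q x => // s IHs p q [|x] pqs odd_pqx.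
  rewrite npathsS0; last by lia.
  case: p q pqs odd_pqx => [|p] [|q] pqs odd_pqx //;
    rewrite ?add0n ?addn0 ?IHs //; lia.
case: p pqs odd_pqx => [|p] pqs odd_pqx; first exact: npaths0S.
by rewrite npathsSS !IHs //; lia.
Qed.

(* Moves two steps from the positive to the negative side: the missing first
   term at [p = 0] stands for [npaths (-1) q.+2 x.+1]. *)
Lemma npathsS_shift (p q x : nat) : npaths p.+1 q x.+1 =
  ((if p is p'.+1 then npaths p' q.+2 x.+1 else 0) +
   npaths q 0 0 * npaths p 0 x)%N.
Proof.
have [s] := ubnP (p + q); elim: s p q x => // s IHs [|p] q x pqs.
  rewrite npathsSS (npaths0S _ x.+1) addn0 add0n.
  by case: x => [|x]; rewrite ?npaths0S ?muln0 // npaths00 muln1 npathsC0.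
rewrite npathsSS (IHs p q x.+1) //.
case: x => [|x]; last first.
  rewrite IHs // npathsSS mulnDr.
  by case: p pqs => [|p] pqs; rewrite ?npaths0S ?npathsSS; lia.
have -> : npaths p.+1 0 0 = npaths p 0 1 by rewrite npathsS0 ?addn0.
case: p pqs => [|p] pqs.
  by rewrite (@npaths_odd 1 q 0) ?npaths0S //; lia.
(* Expand both sides at 0: the induction hypothesis at [(p, q)] and at [(q, p)] yields the same
   product on each side. *)
have -> : npaths p.+2 q 0 = npaths p q.+2 0.
  rewrite !npathsS0; [|lia..].
  rewrite (IHs p q 0%N) ?(IHs q p 0%N); [|lia..].
  by rewrite addnAC [(npaths q 0 0 * _)%N]mulnC addnA.
by rewrite [npaths p.+1 q.+2 1]npathsSS addnA.
Qed.

(** Same cancellation as inside [npathsS_shift], now free of the bound on the length. *)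
Lemma npathsS_shift0 (p q : nat) : npaths p.+2 q 0 = npaths p q.+2 0.
Proof.
rewrite !npathsS0; [|lia..].
rewrite (npathsS_shift p q 0) (npathsS_shift q p 0).
by rewrite addnAC [(npaths q 0 0 * _)%N]mulnC addnA.
Qed.

(** * Ballot and Catalan numbers *)

(* The reflection count [C(N, b) - C(N, b - 1)] of nonnegative paths with [b]
   down-steps, rewritten by Pascal's rule so as to avoid [b - 1]. *)
Lemma ballot (b x : nat) :
  (npaths (b.*2 + x) 0 x + 'C((b.*2 + x).+1, b) = 2 * 'C(b.*2 + x, b))%N.
Proof.
have [s] := ubnP (b.*2 + x); elim: s b x => // s IHs [|b] [|x] bxs.
- by rewrite npaths00 !bin0.
- have := IHs 0%N x; rewrite double0 !add0n !bin0 npathsSS.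
  by rewrite (@npaths_gt x 0 x.+2) // addn0; apply.
- have IH : (npaths b.*2.+1 0 1 + 'C(b.*2.+2, b) = 2 * 'C(b.*2.+1, b))%N.
    by have := IHs b 1%N; rewrite addn1; apply; lia.
  rewrite doubleS addn0 npathsS0 // addn0 (binS b.*2.+2) [in RHS](binS b.*2.+1).
  have eqC : 'C(b.*2.+1, b.+1) = 'C(b.*2.+1, b).
    rewrite -[RHS]bin_sub; last by lia.
    by congr 'C(_, _); lia.
  rewrite (binS b.*2.+1 b) eqC.
  by move: IH; move: (npaths _ _ _) 'C(_, _) 'C(_, b) => h d c; lia.
- have := IHs b x.+2; have := IHs b.+1 x.
  have -> : (b.*2 + x.+2 = b.+1.*2 + x)%N by lia.
  move: bxs; rewrite addnS; move: (b.+1.*2 + x)%N => M Ms IH1 IH2.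
  rewrite npathsSS (binS M.+1 b) [in RHS](binS M b) mulnDr.
  by rewrite -IH1 // -IH2 // addnACA.
Qed.

(** [ballot] at [x = 0], where [(m + 1) C(2m + 1, m) = (2m + 1) C(2m, m)]. *)
Lemma catalan (m : nat) : (m.+1 * npaths m.*2 0 0 = 'C(m.*2, m))%N.
Proof.
have := ballot m 0; rewrite addn0 => bal.
have := mul_bin_down m.*2.+1 m; rewrite /= (_ : (m.*2.+1 - m = m.+1)%N); last lia.
by nia.
Qed.

(** * Summing over endpoints at or above 0 *)

Definition nhalf (p q : nat) : nat := (\sum_(x < p.+1) npaths p q x)%N.

Lemma nhalf_widen (p q M : nat) : (p < M)%N ->
  nhalf p q = (\sum_(x < M) npaths p q x)%N.
Proof.
move=> pM; rewrite /nhalf (big_ord_widen M (npaths p q) pM) big_mkcond.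
by apply: eq_bigr => x _; case: ltnP => // /npaths_gt ->.
Qed.

Lemma nhalf_shift (p q : nat) :
  nhalf p.+2 q = (nhalf p q.+2 + npaths q 0 0 * nhalf p.+1 0)%N.
Proof.
rewrite (@nhalf_widen p _ p.+3) ?[nhalf p.+2 q]/nhalf; last by lia.
rewrite big_ord_recl [in RHS]big_ord_recl npathsS_shift0 -addnA.
rewrite big_distrr -big_split.
by congr addn; apply: eq_bigr => x _; exact: npathsS_shift.
Qed.

(** A nonnegative walk has two nonnegative extensions, unless it stands at 0, where it has one. *)
Lemma nhalfS (p : nat) : (nhalf p.+1 0 + npaths p 0 0 = 2 * nhalf p 0)%N.
Proof.
rewrite {1}/nhalf big_ord_recl (npathsS0 (isT : 0 < p.+1 + 0)%N) addn0.
under eq_bigr do rewrite lift0 npathsSS.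
rewrite big_split /= -/(nhalf p 0).
have : nhalf p 0 = (npaths p 0 0 + (npaths p 0 1 +
    \sum_(x < p.+1) npaths p 0 x.+2))%N.
  by rewrite (@nhalf_widen p 0 p.+3); [rewrite 2!big_ord_recl | lia].
by move: (\sum_(x < _) _)%N => S; lia.
Qed.

Lemma central_binS (m : nat) :
  (m.+1 * 'C(m.+1.*2, m.+1) = 2 * (m.*2.+1 * 'C(m.*2, m)))%N.
Proof.
rewrite doubleS -mul_bin_diag.
have eqC : 'C(m.*2.+1, m) = 'C(m.*2.+1, m.+1).
  by rewrite -[RHS]bin_sub; [congr 'C(_, _)|]; lia.
have := mul_bin_diag m.*2.+1 m; rewrite eqC => /=.
by move: 'C(_, m.+1) 'C(_, m) => a b; nia.
Qed.

Lemma nhalf_even (m : nat) : nhalf m.*2 0 = 'C(m.*2, m).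
Proof.
elim: m => [|m IHm]; first by rewrite /nhalf big_ord1 npaths00.
have c1 : npaths m.*2.+1 0 0 = 0%N by rewrite npaths_odd //; lia.
have := nhalfS m.*2.+1; rewrite c1 addn0 doubleS => ->.
have := nhalfS m.*2; rewrite IHm; have := catalan m; have := central_binS m.
rewrite doubleS.
move: (npaths _ _ _) (nhalf _ _) 'C(_, m.+1) 'C(_, m) => c h C1 C0; nia.
Qed.

(** Induction on [k] for all [m], as [nhalf_shift] trades two positive steps for two negative ones,
    at the cost of a Catalan number times a central binomial coefficient. *)
Lemma nhalf_odd (k m : nat) :
  (2 * (k + m).+1 * nhalf k.*2.+1 m.*2 =
   k.+1 * ('C(k.+1.*2, k.+1) * 'C(m.*2, m)))%N.
Proof.
elim: k m => [|k IHk] m.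
  have -> : nhalf 0.*2.+1 m.*2 = npaths m.*2 0 0.
    rewrite /nhalf double0 big_ord_recl big_ord1 (@npaths_odd 1 _ 0); last by lia.
    by rewrite npathsSS npaths0S addn0 npathsC0.
  by rewrite bin1; have := catalan m; nia.
rewrite doubleS nhalf_shift mulnDr -!doubleS nhalf_even.
have := IHk m.+1; rewrite addnS -addSn => ->.
have := catalan m; have := central_binS m; have := central_binS k.+1.
move: (npaths _ _ _) 'C(_, k.+2) 'C(_, k.+1) 'C(_, m.+1) 'C(_, m) => c a2 a1 b1 b0.
nia.
Qed.

(** * Walks with a prescribed side for the last step *)

Lemma card_nonneg (p q : nat) :
  #|[pred X : walk (p + q) | (0 <= X ord_max) && (sojourn X == p)]| = nhalf p q.
Proof.
have bound (X : walk (p + q)) :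
    0 <= X ord_max -> sojourn X = p -> (`|X ord_max| <= p)%N.
  move=> X0 Xp; rewrite leqNgt; apply/negP => /(npaths_gt q).
  by move=> /card0_eq/(_ X); rewrite !inE gez0_abs // Xp !eqxx.
rewrite -sum1_card.
rewrite (partition_big (fun X : walk _ => inord `|X ord_max|%N : 'I_p.+1)
  predT) //= /nhalf.
apply: eq_bigr => x _; rewrite /npaths /count -sum1_card.
apply: eq_bigl => X; rewrite !inE; have xp := ltn_ord x.
apply/idP/idP => [/andP[/andP[X0 /eqP Xp] /eqP <-]|/andP[/eqP Xx ->]].
  by rewrite inordK ?ltnS ?bound // Xp eqxx andbT gez0_abs.
by rewrite Xx /= inord_val eqxx.
Qed.

(** Drop the last step: what remains ends at or above 0 and allows both last steps, except that at 0
    the down-step is negative. *)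
Lemma card_pos (p q : nat) :
  (#|[set X : walk (p + q).+1 | positive_side X ord_max &
       sojourn X == p.+1]| + npaths p q 0 = 2 * nhalf p q)%N.
Proof.
rewrite cardsE card_walkS mul2n -addnn -addnA -card_nonneg; congr addn.
  apply: eq_card => X; rewrite !inE positive_side_extend sojourn_extend expr0.
  by lia.
rewrite addnC -[RHS](cardID [pred X : walk _ | X ord_max == 0]); congr addn.
  by apply: eq_card => X; rewrite !inE; lia.
apply: eq_card => X; rewrite !inE positive_side_extend sojourn_extend expr1.
by lia.
Qed.

(** For [k > 0], [card_pos] applies with an odd [p], so its correction term vanishes by parity. *)
Lemma card_pos_even (n k : nat) : (k <= n)%N ->
  (n * #|[set X : walk (2 * n) | positive_side X ord_max &
       sojourn X == (2 * k)%N]| =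
   k * ('C(k.*2, k) * 'C((n - k).*2, n - k)))%N.
Proof.
case: n => [|n]; first by case: k.
case: k => [_|k kn].
  rewrite mul0n (eqP (_ : #|_| == 0%N)) ?muln0 // cards_eq0 -subset0.
  apply/subsetP => X; rewrite inE => /andP[Xpos].
  rewrite cards_eq0 => /eqP/setP/(_ ord_max).
  by rewrite !inE Xpos.
have [m ->] : exists m, n = (k + m)%N by exists (n - k)%N; lia.
have e : (2 * (k + m).+1 = (k.*2.+1 + m.*2).+1)%N by lia.
rewrite subSS addKn -nhalf_odd mulnC -mulnA mulnCA [in RHS]mulnC.
congr muln; rewrite e (_ : (2 * k.+1 = k.*2.+2)%N); last by lia.
by rewrite -card_pos npaths_odd ?addn0 //; lia.
Qed.

Lemma card_neg (n k : nat) : (0 < n)%N -> (k <= n)%N ->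
  #|[set X : walk (2 * n) | ~~ positive_side X ord_max &
       sojourn X == (2 * k)%N]| =
  #|[set X : walk (2 * n) | positive_side X ord_max &
       sojourn X == (2 * (n - k))%N]|.
Proof.
move=> n0 kn; rewrite -[RHS](card_imset _ (inv_inj (@opp_walkK _))).
apply: eq_card => X; rewrite (can_imset_pre _ (@opp_walkK _)) !inE.
rewrite positive_side_opp; last by rewrite /= muln_gt0.
by congr andb; have := sojourn_opp X; lia.
Qed.

Theorem theorem6 (R : realFieldType) (n k : nat)
    (hn : (1 <= n)%N) (hk : (k <= n)%N) :
  cond_prob R [set X : walk (2 * n) | positive_side X ord_max]
              [set X : walk (2 * n) | sojourn X == (2 * k)%N]
  = k%:R / n%:R.
Proof.
set A := [set X : walk _ | positive_side X _].
set B := [set X : walk _ | sojourn X == _].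
have cAB : (n * #|A :&: B| = k * ('C(k.*2, k) * 'C((n - k).*2, n - k)))%N.
  by rewrite -card_pos_even //; congr muln; apply: eq_card => X; rewrite !inE.
(* By reflection this is the previous count at [n - k], whose binomial product is symmetric. *)
have cBA : (n * #|B :\: A| =
    (n - k) * ('C(k.*2, k) * 'C((n - k).*2, n - k)))%N.
  have := card_pos_even (leq_subr k n).
  rewrite subKn // [('C(_, k) * _)%N]mulnC => <-; rewrite -card_neg //.
  by congr muln; apply: eq_card => X; rewrite !inE.
(* The weights [k] and [n - k] add up to [n], which cancels. *)
have cB : #|B| = ('C(k.*2, k) * 'C((n - k).*2, n - k))%N.
  apply/eqP; rewrite -(eqn_pmul2l hn) -(cardsID A) mulnDr setIC cAB cBA.
  by rewrite -mulnDl subnKC.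
have B0 : #|B|%:R != 0 :> R.
  by rewrite pnatr_eq0 cB muln_eq0 negb_or -!lt0n !bin_gt0; lia.
have W0 : #|{: walk (2 * n)}|%:R != 0 :> R.
  by rewrite pnatr_eq0 card_walk expn_eq0.
have n0 : n%:R != 0 :> R by rewrite pnatr_eq0 -lt0n.
rewrite /cond_prob /prob -mulf_div divff ?mulr1 ?invr_eq0 //.
by apply/eqP; rewrite eqr_div // -!natrM [(_ * n)%N]mulnC cAB cB.
Qed.
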